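(* Let $R\ge 1$ be an integer, let $B \in \mathbb{R}^{R\times R}$ be a symmetric matrix with positive entries, and let $u \in \mathbb{R}^R$ be a vector with positive entries. Then the matrix $$\operatorname{Diag}\left(\frac{Bu}{u}\right) - B$$ is positive semi-definite.
   Context: The division of two vectors is entrywise, so $\frac{Bu}{u}$ is the vector with $r$-th entry $(Bu)_r/u_r$. For a vector $x$, $\operatorname{Diag}(x)$ is the diagonal matrix whose diagonal entries are the entries of $x$. A matrix $A\in\mathbb{R}^{R\times R}$ is positive semi-definite if $h^\top A h\ge 0$ for all $h\in\mathbb{R}^R$. *)

(* Defs.v *)
From mathcomp Require Import all_boot all_order all_algebra.
From mathcomp Require Import reals.

Set Implicit Arguments.
Unset Strict Implicit.
Unset Printing Implicit Defensive.

Import Order.TTheory GRing.Theory Num.Theory.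

Local Open Scope ring_scope.

Definition vdiv (K : realType) (n : nat) (x y : 'cV[K]_n) : 'cV[K]_n :=
  map2_mx (fun a b => a / b) x y.

(* Vectors are columns here, whereas diag_mx expects a row. *)
Definition Diag (K : realType) (n : nat) (x : 'cV[K]_n) : 'M[K]_n :=
  diag_mx x^T.

(* Symmetry of A is not part of the definition; h^T A h is a 1 x 1 matrix, hence
   the entry 0 0. *)
Definition psd (K : realType) (n : nat) (A : 'M[K]_n) : Prop :=
  forall h : 'cV[K]_n, 0 <= (h^T *m A *m h) 0 0.

(* Main.v *)
(* By symmetry of B, twice the quadratic form at h equals
   \sum_(i, j) B_ij u_i u_j (h_i / u_i - h_j / u_j)^2. *)
Require Import Defs.
From mathcomp Require Import all_boot all_order all_algebra.
From mathcomp Require Import reals.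
From mathcomp Require Import ring.

Set Implicit Arguments.
Unset Strict Implicit.
Unset Printing Implicit Defensive.

Import Order.TTheory GRing.Theory Num.Theory.

Local Open Scope ring_scope.

(** [quad_form_Diag_sub] writes the form as a double sum over [(i, j)]. Its terms may have either
    sign, but by symmetry of [B] the terms at [(i, j)] and [(j, i)] add up to a nonnegative multiple
    of a square; [sum_sym_ge0] shows that this suffices. *)

Lemma quad_form_Diag_sub (K : realType) (n : nat) (B : 'M[K]_n)
    (u h : 'cV[K]_n) :
  (h^T *m (Diag (vdiv (B *m u) u) - B) *m h) 0 0 =
  \sum_i \sum_j B i j * (u j 0 / u i 0 * h i 0 ^+ 2 - h i 0 * h j 0).
Proof.
rewrite mulmxBr mulmxBl !mxE.
under [X in _ - X]eq_bigr => j _ do rewrite mxE mulr_suml.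
(* The exchange puts the row index of [B] outermost in [h^T B h], to match the diagonal part. *)
rewrite exchange_big -sumrB; apply: eq_bigr => i _.
rewrite /Diag mul_mx_diag !mxE mulr_suml mulr_sumr mulr_suml -sumrB.
by apply: eq_bigr => j _; ring.
Qed.

(** Adding the sum to its transposed copy doubles it and pairs [F i j] with [F j i]. *)
Lemma sum_sym_ge0 (K : realDomainType) (n : nat) (F : 'I_n -> 'I_n -> K) :
  (forall i j, 0 <= F i j + F j i) -> 0 <= \sum_i \sum_j F i j.
Proof.
move=> F_ge0; rewrite -(pmulrn_lge0 _ (ltn0Sn 1)) mulr2n.
rewrite [X in _ + X]exchange_big -big_split /= sumr_ge0 // => i _.
by rewrite -big_split /= sumr_ge0.
Qed.

Theorem proposition1 (K : realType) (R : nat) (hR : (1 <= R)%N)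
    (B : 'M[K]_R) (u : 'cV[K]_R)
    (Bsym : B^T = B)
    (Bpos : forall i j, 0 < B i j)
    (upos : forall i, 0 < u i 0) :
  psd (Diag (vdiv (B *m u) u) - B).
Proof.
move=> h; rewrite quad_form_Diag_sub; apply: sum_sym_ge0 => i j.
have -> : B j i = B i j by rewrite -[in LHS]Bsym mxE.
have ui0 : u i 0 != 0 by rewrite gt_eqF.
have uj0 : u j 0 != 0 by rewrite gt_eqF.
(* Completing the square in [h i 0 / u i 0] and [h j 0 / u j 0]; the cross term is
   [- 2 h_i h_j B_ij]. *)
rewrite [leRHS](_ : _ =
  B i j * (u i 0 * u j 0) * (h i 0 / u i 0 - h j 0 / u j 0) ^+ 2).
  by rewrite mulr_ge0 ?sqr_ge0 // !mulr_ge0 // ltW.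
by field; rewrite ui0 uj0.
Qed.
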